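(* Let $(\gamma,\widetilde\gamma)$ be a non-helical and non-planar Bertrand pair in Euclidean 3-space ($\gamma$ the Bertrand curve, $\widetilde\gamma$ its Bertrand mate). Then the Bertrand mate curve $\widetilde\gamma$ is a slant helix if and only if the binormal indicatrix $\gamma_b=B$ of the Bertrand curve $\gamma$ is a spherical helix.
   Context: Curves are smooth regular curves in $\mathbb{R}^3$ with non-vanishing curvature; $\gamma$ is parameterized by arclength $s$ with Frenet frame $T,N,B$, curvature $\kappa$, torsion $\tau$, and $\widetilde\gamma$ by arclength $s^{*}$ with $\widetilde T,\widetilde N,\widetilde B,\widetilde\kappa,\widetilde\tau$. The pair $(\gamma,\widetilde\gamma)$ is a Bertrand pair if there is a correspondence of points such that the principal normals at corresponding points are linearly dependent, $N=\epsilon\widetilde N$ with $\epsilon=\pm1$, and $\widetilde\gamma(s^{*})=\gamma(s)+\lambda N(s)$ with $\lambda\neq0$ constant. Non-helical means that torsion/curvature of each curve is not constant, non-planar that the torsions are non-zero; the quotients $\tau/\kappa$, $\tau'/\kappa'$, $\widetilde\tau/\widetilde\kappa$, $\widetilde\tau'/\widetilde\kappa'$ are assumed to be defined (denominators non-zero, and the two quotients of each curve different and non-zero at each point). A slant helix is a curve whose principal normal lines make a constant angle with a fixed straight line. The binormal indicatrix of $\gamma$ is the curve $s\mapsto B(s)$ on the unit sphere. A spherical helix is a curve on the sphere which is a (general) helix, i.e. the ratio of its torsion to its curvature is constant. *)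

(* Defs.v *)
From mathcomp Require Export all_boot all_order all_algebra.
From mathcomp Require Export all_classical all_reals all_analysis.
Set Implicit Arguments.
Unset Strict Implicit.
Unset Printing Implicit Defensive.
Import Order.TTheory GRing.Theory Num.Theory.
Export numFieldNormedType.Exports.

Local Open Scope classical_set_scope.
Local Open Scope ring_scope.

Definition dotv (R : realType) (u v : 'rV[R]_3) : R :=
  \sum_(i < 3) u 0 i * v 0 i.

(* Euclidean norm; the library norm `|u| on matrices is the sup norm. *)
Definition normv (R : realType) (u : 'rV[R]_3) : R := Num.sqrt (dotv u u).

(* The index arithmetic is that of 'I_3, i.e. modulo 3. *)
Definition crossv (R : realType) (u v : 'rV[R]_3) : 'rV[R]_3 :=
  \row_(k < 3) (u 0 (k + 1) * v 0 (k + 2) - u 0 (k + 2) * v 0 (k + 1)).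

(* Unoriented angle, in [0, pi/2], of two lines with nonzero directions u, v. *)
Definition line_angle (R : realType) (u v : 'rV[R]_3) : R :=
  acos (`|dotv u v| / (normv u * normv v)).

Definition open_interval (R : realType) (I : set R) : Prop :=
  [/\ open I, is_interval I & I !=set0].

Definition smooth_on (R : realType) (I : set R) (f : R -> 'rV[R]_3) : Prop :=
  forall (n : nat) (t : R), I t -> derivable (f^`(n))%classic t 1.

Definition speed (R : realType) (c : R -> 'rV[R]_3) (t : R) : R :=
  normv (c^`() t)%classic.

(* Derivative of f with respect to the arclength of c, for an arbitrary regular
   parameter t: d/ds = |c'(t)|^-1 d/dt.  The Frenet apparatus below thus makes
   sense for any regular curve (the binormal indicatrix need not be
   parameterized by arclength); if c has unit speed, it is the usual one, with
   T = c', kappa = |T'|, N = T' / kappa, B = T x N, B' = - tau N. *)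
Definition arc_deriv (R : realType) (V : normedModType R)
    (c : R -> 'rV[R]_3) (f : R -> V) (t : R) : V :=
  (speed c t)^-1 *: (f^`() t)%classic.

Definition tangent (R : realType) (c : R -> 'rV[R]_3) : R -> 'rV[R]_3 :=
  arc_deriv c c.

Definition curvature (R : realType) (c : R -> 'rV[R]_3) (t : R) : R :=
  normv (arc_deriv c (tangent c) t).

Definition normal (R : realType) (c : R -> 'rV[R]_3) (t : R) : 'rV[R]_3 :=
  (curvature c t)^-1 *: arc_deriv c (tangent c) t.

Definition binormal (R : realType) (c : R -> 'rV[R]_3) (t : R) : 'rV[R]_3 :=
  crossv (tangent c t) (normal c t).

Definition torsion (R : realType) (c : R -> 'rV[R]_3) (t : R) : R :=
  - dotv (arc_deriv c (binormal c) t) (normal c t).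

Definition frenet_curve (R : realType) (I : set R) (c : R -> 'rV[R]_3) : Prop :=
  [/\ open_interval I,
      smooth_on I c,
      forall t, I t -> (c^`() t)%classic != 0 &
      forall t, I t -> curvature c t != 0].

Definition arclength_curve (R : realType) (I : set R) (c : R -> 'rV[R]_3)
    : Prop :=
  frenet_curve I c /\ forall s, I s -> speed c s = 1.

(* phi sends the arclength s of c to the arclength s* of the corresponding
   point of d. *)
Definition bertrand_pair (R : realType) (I J : set R) (c d : R -> 'rV[R]_3)
    : Prop :=
  exists (phi : R -> R) (eps lambda : R),
    [/\ set_bij I J phi,
        eps = 1 \/ eps = -1,
        lambda != 0,
        forall s, I s -> normal c s = eps *: normal d (phi s) &
        forall s, I s -> d (phi s) = c s + lambda *: normal c s].

Definition constant_ratio (R : realType) (I : set R) (c : R -> 'rV[R]_3)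
    : Prop :=
  exists k : R, forall t, I t -> torsion c t / curvature c t = k.

Definition non_helical (R : realType) (I : set R) (c : R -> 'rV[R]_3) : Prop :=
  ~ constant_ratio I c.

Definition non_planar (R : realType) (I : set R) (c : R -> 'rV[R]_3) : Prop :=
  forall t, I t -> torsion c t != 0.

(* For c parameterized by arclength: tau / kappa and tau' / kappa' are defined,
   non-zero and different at each point. *)
Definition admissible_quotients (R : realType) (I : set R)
    (c : R -> 'rV[R]_3) : Prop :=
  forall s, I s ->
    [/\ curvature c s != 0 /\ ((curvature c)^`() s)%classic != 0,
        torsion c s / curvature c s != 0,
        ((torsion c)^`() s)%classic / ((curvature c)^`() s)%classic != 0 &
        torsion c s / curvature c s
          != ((torsion c)^`() s)%classic / ((curvature c)^`() s)%classic].

Definition slant_helix (R : realType) (I : set R) (c : R -> 'rV[R]_3) : Prop :=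
  frenet_curve I c /\
  exists (u : 'rV[R]_3) (theta : R),
    u != 0 /\ forall t, I t -> line_angle (normal c t) u = theta.

Definition spherical_helix (R : realType) (I : set R) (c : R -> 'rV[R]_3)
    : Prop :=
  [/\ frenet_curve I c,
      forall t, I t -> normv (c t) = 1 &
      constant_ratio I c].

(* Main.v *)
(** The principal normal of the mate is, up to sign, that of the Bertrand curve,
    so the mate is a slant helix iff [N . u] is constant up to sign for some
    [u <> 0].  As [B' = - tau N], the unit tangent of the curve [B] is [N] up to
    sign, and by Lancret's theorem [B] is a helix iff this tangent makes a
    constant angle with a fixed line, which is the same condition.
    Angles with lines enter as squares [(N . u)^2], so the sign of [tau] never
    has to be tracked along the interval. *)
Require Import Defs.
From mathcomp Require Import ring lra.
Set Implicit Arguments.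
Unset Strict Implicit.
Unset Printing Implicit Defensive.
Import Order.TTheory GRing.Theory Num.Theory.
Local Open Scope classical_set_scope.
Local Open Scope ring_scope.

(** * Euclidean vector algebra in dimension 3 *)

Section vector_algebra.
Context {R : realType}.
Implicit Types (u v w : 'rV[R]_3) (k : R).

Lemma dotvE u v :
  dotv u v = u 0 0 * v 0 0 + u 0 1 * v 0 1 + u 0 2 * v 0 2.
Proof.
rewrite /dotv !big_ord_recl big_ord0 addr0 addrA.
by congr (_ + _ * _ + _ * _); congr (_ _ _); exact: val_inj.
Qed.

(** Replaces the indices modulo 3 by literal coordinates, so that vector identities become
    polynomial identities within reach of [ring]. *)
Lemma crossvE u v : crossv u v = \row_k
  [:: u 0 1 * v 0 2 - u 0 2 * v 0 1; u 0 2 * v 0 0 - u 0 0 * v 0 2;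
      u 0 0 * v 0 1 - u 0 1 * v 0 0]`_k.
Proof.
apply/rowP => -[[|[|[|//]]] lt3]; rewrite !mxE /=;
  by congr (_ * _ - _ * _); congr (_ _ _); exact: val_inj.
Qed.

Lemma row3P u v :
  u 0 0 = v 0 0 -> u 0 1 = v 0 1 -> u 0 2 = v 0 2 -> u = v.
Proof.
move=> e0 e1 e2; apply/rowP => -[[|[|[|//]]] lt3].
- by rewrite (_ : Ordinal lt3 = 0) //; exact: val_inj.
- by rewrite (_ : Ordinal lt3 = 1) //; exact: val_inj.
- by rewrite (_ : Ordinal lt3 = 2) //; exact: val_inj.
Qed.

Lemma dotvC u v : dotv u v = dotv v u.
Proof. by rewrite !dotvE; ring. Qed.

Lemma dotvDl u v w : dotv (u + v) w = dotv u w + dotv v w.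
Proof. by rewrite !dotvE !mxE; ring. Qed.

Lemma dotvZl k u v : dotv (k *: u) v = k * dotv u v.
Proof. by rewrite !dotvE !mxE; ring. Qed.

Lemma dotvDr u v w : dotv u (v + w) = dotv u v + dotv u w.
Proof. by rewrite !dotvE !mxE; ring. Qed.

Lemma dotvZr k u v : dotv u (k *: v) = k * dotv u v.
Proof. by rewrite !dotvE !mxE; ring. Qed.

Lemma dotv0 u : dotv u 0 = 0.
Proof. by rewrite !dotvE !mxE; ring. Qed.

Lemma dotvv_ge0 u : 0 <= dotv u u.
Proof. by rewrite dotvE !addr_ge0 // -expr2 sqr_ge0. Qed.

Lemma dotvv_eq0 u : (dotv u u == 0) = (u == 0).
Proof.
apply/eqP/eqP => [|->]; last exact: dotv0.
rewrite dotvE => u0; apply: row3P; rewrite mxE; nra.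
Qed.

Lemma dotvv_gt0 u : (0 < dotv u u) = (u != 0).
Proof. by rewrite lt_def dotvv_ge0 andbT dotvv_eq0. Qed.

Lemma sqr_normv u : normv u ^+ 2 = dotv u u.
Proof. by rewrite sqr_sqrtr ?dotvv_ge0. Qed.

Lemma normv_eq0 u : (normv u == 0) = (u == 0).
Proof. by rewrite -sqrf_eq0 sqr_normv dotvv_eq0. Qed.

Lemma normv_gt0 u : (0 < normv u) = (u != 0).
Proof. by rewrite lt_def sqrtr_ge0 andbT normv_eq0. Qed.

Lemma normvZ k u : normv (k *: u) = `|k| * normv u.
Proof.
by rewrite /normv dotvZl dotvZr mulrA -expr2 sqrtrM ?sqr_ge0 // sqrtr_sqr.
Qed.

(** Lagrange's identity. It yields both the Cauchy-Schwarz inequality and the unit length of the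
    cross product of two orthonormal vectors. *)
Lemma dotv_sqr_crossv u v :
  dotv u v ^+ 2 + dotv (crossv u v) (crossv u v) = dotv u u * dotv v v.
Proof. by rewrite crossvE !dotvE !mxE /=; ring. Qed.

Lemma dotv_crossvl u v : dotv u (crossv u v) = 0.
Proof. by rewrite crossvE !dotvE !mxE /=; ring. Qed.

Lemma dotv_crossvr u v : dotv v (crossv u v) = 0.
Proof. by rewrite crossvE !dotvE !mxE /=; ring. Qed.

Lemma crossv_crossv u v w :
  crossv u (crossv v w) = dotv u w *: v - dotv u v *: w.
Proof. by rewrite !crossvE !dotvE; apply: row3P; rewrite !mxE /=; ring. Qed.

Lemma Cauchy_Schwarz u v : `|dotv u v| <= normv u * normv v.
Proof.
rewrite -(@ler_pXn2r _ 2) ?nnegrE ?mulr_ge0 ?sqrtr_ge0 //.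
rewrite exprMn !sqr_normv real_normK ?num_real // -dotv_sqr_crossv.
by rewrite lerDl dotvv_ge0.
Qed.

(** Put b = u x v. The triple product formula gives w x b = (w . v) u - (w . u) v = 0, and then b x
    (w x b) = (b . b) w - (b . w) b = w, so w = b x 0 = 0. *)
Lemma orthonormal_eq0 u v w :
  dotv u u = 1 -> dotv v v = 1 -> dotv u v = 0 ->
  dotv w u = 0 -> dotv w v = 0 -> dotv w (crossv u v) = 0 -> w = 0.
Proof.
move=> uu vv uv wu wv wb; set b := crossv u v in wb *.
have bb : dotv b b = 1.
  by have := dotv_sqr_crossv u v; rewrite uu vv uv expr0n add0r mulr1.
have wb0 : crossv w b = 0 by rewrite crossv_crossv wu wv !scale0r subr0.
have := crossv_crossv b w b; rewrite wb0 bb (dotvC b) wb scale0r subr0 scale1r.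
by move=> <-; rewrite crossvE; apply: row3P; rewrite !mxE /=; ring.
Qed.

Lemma orthonormal_expand u v w :
  dotv u u = 1 -> dotv v v = 1 -> dotv u v = 0 ->
  w = dotv w u *: u + dotv w v *: v + dotv w (crossv u v) *: crossv u v.
Proof.
move=> uu vv uv; set b := crossv u v.
have bb : dotv b b = 1.
  by have := dotv_sqr_crossv u v; rewrite uu vv uv expr0n add0r mulr1.
have ub : dotv u b = 0 by exact: dotv_crossvl.
have vb : dotv v b = 0 by exact: dotv_crossvr.
apply/eqP; rewrite -subr_eq0 -scaleN1r; apply/eqP.
apply: (orthonormal_eq0 uu vv uv); rewrite -/b;
rewrite !(dotvDl, dotvZl) ?(dotvC v u) ?(dotvC b u) ?(dotvC b v);
rewrite ?uu ?vv ?uv ?bb ?ub ?vb; ring.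
Qed.

End vector_algebra.

(** * Derivatives of vector functions, coordinate by coordinate *)

Section vector_derivatives.
Context {R : realType}.
Implicit Types (u v : R -> 'rV[R]_3) (f : R -> R) (t : R).

Lemma is_derive_rowP u t (u' : 'rV[R]_3) :
  is_derive t 1 u u' <-> forall i, is_derive t 1 (fun x => u x 0 i) (u' 0 i).
Proof.
split=> [[du <-] i|du].
  split; first exact: ((derivable_mxP u t 1).1 du).
  by rewrite derive_mx // mxE.
have dut : derivable u t 1.
  by apply/derivable_mxP => i j; rewrite (ord1 i); case: (du j).
split=> //; rewrite derive_mx //; apply/rowP => j; rewrite mxE.
by case: (du j).
Qed.

Lemma is_derive_dotv u v t (u' v' : 'rV[R]_3) :
  is_derive t 1 u u' -> is_derive t 1 v v' ->
  is_derive t 1 (fun x => dotv (u x) (v x)) (dotv u' (v t) + dotv (u t) v').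
Proof.
move=> /is_derive_rowP du /is_derive_rowP dv.
have -> : (fun x => dotv (u x) (v x)) =
    (fun x => u x 0 0) * (fun x => v x 0 0) +
    (fun x => u x 0 1) * (fun x => v x 0 1) +
    (fun x => u x 0 2) * (fun x => v x 0 2).
  by apply/funext => x; rewrite dotvE.
apply: is_derive_eq (is_deriveD (is_deriveD (is_deriveM (du 0) (dv 0))
  (is_deriveM (du 1) (dv 1))) (is_deriveM (du 2) (dv 2))) _.
rewrite !dotvE /GRing.scale /=; ring.
Qed.

End vector_derivatives.

(** * Closure properties of finite-order differentiability on an open set *)

Section smoothness.
Context {R : realType}.
Implicit Types (I : set R) (n : nat) (t : R).

(** The order counts from derivability: [n = 0] already asks for one derivative, and [n] for [n.+1]
    of them. The recursion peels off the first derivative, whereas the iterated derivative in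
    [smooth_on] adds one on the outside; this form suits induction on [n] with [f] general. *)
Fixpoint derivable_upto (V : normedModType R) n I (f : R -> V) : Prop :=
  (forall t, I t -> derivable f t 1) /\
  (if n is k.+1 then derivable_upto k I (f^`())%classic else True).

Lemma derivable_upto_derivable (V : normedModType R) n I (f : R -> V) t :
  derivable_upto n I f -> I t -> derivable f t 1.
Proof. by case: n => [|n] [df _]; exact: df. Qed.

Lemma derivable_upto_derive1 (V : normedModType R) n I (f : R -> V) :
  derivable_upto n.+1 I f -> derivable_upto n I (f^`())%classic.
Proof. by case. Qed.

Lemma derivable_uptoW (V : normedModType R) n I (f : R -> V) :
  derivable_upto n.+1 I f -> derivable_upto n I f.
Proof.
elim: n f => [|n ih] f [df df']; first by split.
by split=> //; exact: ih.
Qed.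

Lemma derivable_uptoP (V : normedModType R) n I (f : R -> V) :
  derivable_upto n I f <->
  forall k, (k <= n)%N -> forall t, I t -> derivable (f^`(k))%classic t 1.
Proof.
elim: n f => [|n ih] f.
  split=> [[df _] [|//] _|df]; first exact: df.
  by split=> //; exact: (df 0%N).
split=> [[df /ih df'] [|k] lekn t It|df].
- exact: df.
- by rewrite derive1Sn; exact: df'.
- split; first exact: (df 0%N).
  by apply/ih => k lekn t It; rewrite -derive1Sn; exact: df.
Qed.

Lemma is_derive1 (V : normedModType R) (f : R -> V) t :
  derivable f t 1 -> is_derive t 1 f ((f^`())%classic t).
Proof. by move=> df; rewrite derive1E; split. Qed.

Lemma is_derive1E (V : normedModType R) (f : R -> V) t (f' : V) :
  is_derive t 1 f f' -> (f^`())%classic t = f'.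
Proof. by move=> [_ <-]; rewrite derive1E. Qed.

Lemma near_eq_on (V : normedModType R) I (f g : R -> V) t :
  open I -> {in I, f =1 g} -> I t -> \near t, f t = g t.
Proof.
move=> oI fg It; near=> x; apply: fg; rewrite inE; near: x.
exact: open_nbhs_nbhs.
Unshelve. all: by end_near. Qed.

Lemma is_derive_on (V : normedModType R) I (f g : R -> V) t (f' : V) :
  open I -> {in I, f =1 g} -> I t -> is_derive t 1 f f' -> is_derive t 1 g f'.
Proof.
by move=> oI fg It; apply: near_eq_is_derive; exact: near_eq_on It.
Qed.

(** Differentiation rules give a derivative at the points of [I] alone. Since [I] is open, equality
    on [I] is equality near each of its points, so it passes to the derivatives of every order. *)
Lemma derivable_upto_on (V : normedModType R) n I (f g : R -> V) :
  open I -> {in I, f =1 g} -> derivable_upto n I f -> derivable_upto n I g.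
Proof.
move=> oI; elim: n f g => [|n ih] f g fg df.
  split; [move=> t It|by []].
  by apply: (near_eq_derivable (near_eq_on oI fg It));
     exact: (derivable_upto_derivable df It).
split=> [t It|].
  by apply: (near_eq_derivable (near_eq_on oI fg It));
     exact: (derivable_upto_derivable df It).
apply: (ih (f^`())%classic); last exact: derivable_upto_derive1.
move=> t; rewrite inE => It; rewrite !derive1E.
exact: near_eq_derive (near_eq_on oI fg It).
Qed.

(* By induction on the order, this reduces the closure properties of
   [derivable_upto] to the differentiation rules. *)
Lemma derivable_upto_is_derive (V : normedModType R) n I (f f' : R -> V) :
  open I -> (forall t, I t -> is_derive t 1 f (f' t)) ->
  derivable_upto n I f' -> derivable_upto n.+1 I f.
Proof.
move=> oI df df'; split=> [t /df[]//|].
apply: derivable_upto_on df' => // t; rewrite inE => /df /is_derive1E.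
by [].
Qed.

Lemma derivable_uptoD (V : normedModType R) n I (f g : R -> V) :
  open I -> derivable_upto n I f -> derivable_upto n I g ->
  derivable_upto n I (fun t => f t + g t).
Proof.
move=> oI; elim: n f g => [|n ih] f g df dg.
  split; [move=> t It|by []].
  by apply: derivableD; [exact: (derivable_upto_derivable df It)|
    exact: (derivable_upto_derivable dg It)].
refine (derivable_upto_is_derive (f' := fun t =>
  (f^`())%classic t + (g^`())%classic t)
  oI _ _) => [t It|].
  exact: is_deriveD (is_derive1 (derivable_upto_derivable df It))
    (is_derive1 (derivable_upto_derivable dg It)).
exact: ih (derivable_upto_derive1 df) (derivable_upto_derive1 dg).
Qed.

Lemma derivable_uptoM n I (f g : R -> R) :
  open I -> derivable_upto n I f -> derivable_upto n I g ->
  derivable_upto n I (fun t => f t * g t).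
Proof.
move=> oI; elim: n f g => [|n ih] f g df dg.
  split; [move=> t It|by []].
  by apply: derivableM; [exact: (derivable_upto_derivable df It)|
    exact: (derivable_upto_derivable dg It)].
refine (derivable_upto_is_derive (f' := fun t =>
  f t * (g^`())%classic t + g t * (f^`())%classic t) oI _ _) => [t It|].
  exact: is_deriveM (is_derive1 (derivable_upto_derivable df It))
    (is_derive1 (derivable_upto_derivable dg It)).
(* In f g' + g f' each function meets the derivative of the other, so its own order is lowered by
   one to match. *)
exact (derivable_uptoD oI
  (ih _ _ (derivable_uptoW df) (derivable_upto_derive1 dg))
  (ih _ _ (derivable_uptoW dg) (derivable_upto_derive1 df))).
Qed.

Lemma derivable_upto_cst (V : normedModType R) n I (a : V) :
  open I -> derivable_upto n I (cst a).
Proof.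
move=> oI; elim: n a => [|n ih] a; first by [].
exact (derivable_upto_is_derive (f' := cst 0) oI
  (fun t _ => is_derive_cst a t 1) (ih 0)).
Qed.

(** The derivative of 1/f is a polynomial in 1/f and f', and the induction hypothesis handles 1/f at
    one order less. *)
Lemma derivable_uptoV n I (f : R -> R) :
  open I -> (forall t, I t -> f t != 0) ->
  derivable_upto n I f -> derivable_upto n I (fun t => (f t)^-1).
Proof.
move=> oI f0; elim: n => [|n ih] df.
  by split; [move=> t It|by []]; apply: derivableV;
    [exact: f0|exact: (derivable_upto_derivable df It)].
(* The derivative is written as a plain product, with a constant factor -1 for the sign, so that
   closure under products applies to it. *)
refine (derivable_upto_is_derive (f' := fun t =>
  -1 * ((f t)^-1 * (f t)^-1 * (f^`())%classic t)) oI _ _) => [t It|].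
  have dft := is_derive1 (derivable_upto_derivable df It).
  apply: is_derive_eq (is_deriveV (f0 _ It) dft) _.
  have invfE (a b : R) : - a ^- 2 * b = -1 * (a^-1 * a^-1 * b).
    by rewrite mulN1r mulNr expr2 invfM.
  exact: invfE.
have dV := ih (derivable_uptoW df).
refine (derivable_uptoM oI (derivable_upto_cst _ _ oI) _).
exact (derivable_uptoM oI (derivable_uptoM oI dV dV)
  (derivable_upto_derive1 df)).
Qed.

(** Same bootstrap as for the inverse: f' / (2 sqrt f) involves sqrt f one order lower. Positivity
    keeps [f] away from 0, where the square root is not differentiable. *)
Lemma derivable_upto_sqrt n I (f : R -> R) :
  open I -> (forall t, I t -> 0 < f t) ->
  derivable_upto n I f -> derivable_upto n I (fun t => Num.sqrt (f t)).
Proof.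
move=> oI f0.
have dsq t : I t -> derivable f t 1 -> is_derive t 1 (fun t => Num.sqrt (f t))
    (2^-1 * ((Num.sqrt (f t))^-1 * (f^`())%classic t)).
  move=> It /is_derive1 dft.
  apply: (is_derive_eq (is_derive1_comp (is_derive1_sqrt (f0 t It)) dft)).
  by rewrite invfM mulrA.
elim: n => [|n ih] df.
  split; [move=> t It|by []].
  by have [] := dsq t It (derivable_upto_derivable df It).
refine (derivable_upto_is_derive (f' := fun t =>
  2^-1 * ((Num.sqrt (f t))^-1 * (f^`())%classic t)) oI _ _) => [t It|].
  exact: dsq It (derivable_upto_derivable df It).
have f0' t : I t -> Num.sqrt (f t) != 0.
  by move=> /f0; rewrite -sqrtr_gt0 lt0r => /andP[].
refine (derivable_uptoM oI (derivable_upto_cst _ _ oI) _).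
exact (derivable_uptoM oI (derivable_uptoV oI f0' (ih (derivable_uptoW df)))
  (derivable_upto_derive1 df)).
Qed.

(** Carries the closure properties of real functions over to scaling, dot products and cross
    products of vector functions. *)
Lemma derivable_upto_rowP n I (u : R -> 'rV[R]_3) : open I ->
  derivable_upto n I u <-> forall i, derivable_upto n I (fun t => u t 0 i).
Proof.
move=> oI; elim: n u => [|n ih] u.
  split=> [du i|du]; (split; [move=> t It|by []]).
    by apply: (derivable_mxP u t 1).1; exact: (derivable_upto_derivable du It).
  by apply/derivable_mxP => i j; rewrite (ord1 i);
     exact: (derivable_upto_derivable (du j) It).
split=> [du i|du].
  refine (derivable_upto_is_derive (f' := fun t => (u^`())%classic t 0 i)
    oI _ _) => [t It|].
    exact: (is_derive_rowP _ _ _).1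
      (is_derive1 (derivable_upto_derivable du It)) i.
  exact: (ih _).1 (derivable_upto_derive1 du) i.
refine (derivable_upto_is_derive (f' := fun t =>
  \row_i ((fun t => u t 0 i)^`())%classic t) oI _ _) => [t It|].
  by apply/is_derive_rowP => i; rewrite mxE; apply: is_derive1;
     exact: (derivable_upto_derivable (du i) It).
apply/ih => i; rewrite (_ : (fun _ => _) = ((fun t => u t 0 i)^`())%classic).
  exact: derivable_upto_derive1 (du i).
by apply/funext => t; rewrite mxE.
Qed.

Lemma derivable_upto_scale n I (f : R -> R) (u : R -> 'rV[R]_3) :
  open I -> derivable_upto n I f -> derivable_upto n I u ->
  derivable_upto n I (fun t => f t *: u t).
Proof.
move=> oI df /(derivable_upto_rowP _ _ oI) du.
apply/(derivable_upto_rowP _ _ oI) => i.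
rewrite (_ : (fun _ => _) = (fun t => f t * u t 0 i)); last first.
  by apply/funext => t; rewrite mxE.
exact: derivable_uptoM.
Qed.

Lemma derivable_upto_dotv n I (u v : R -> 'rV[R]_3) :
  open I -> derivable_upto n I u -> derivable_upto n I v ->
  derivable_upto n I (fun t => dotv (u t) (v t)).
Proof.
move=> oI /(derivable_upto_rowP _ _ oI) du /(derivable_upto_rowP _ _ oI) dv.
rewrite (_ : (fun _ => _) = (fun t => u t 0 0 * v t 0 0 + u t 0 1 * v t 0 1 +
  u t 0 2 * v t 0 2)); last by apply/funext => t; rewrite dotvE.
by do ?apply: derivable_uptoD => //; exact: derivable_uptoM.
Qed.

Lemma derivable_upto_crossv n I (u v : R -> 'rV[R]_3) :
  open I -> derivable_upto n I u -> derivable_upto n I v ->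
  derivable_upto n I (fun t => crossv (u t) (v t)).
Proof.
move=> oI /(derivable_upto_rowP _ _ oI) du /(derivable_upto_rowP _ _ oI) dv.
apply/(derivable_upto_rowP _ _ oI) => i.
rewrite (_ : (fun _ => _) = (fun t => u t 0 (i + 1) * v t 0 (i + 2) +
  -1 * (u t 0 (i + 2) * v t 0 (i + 1)))); last first.
  by apply/funext => t; rewrite mxE mulN1r.
apply: derivable_uptoD => //; first exact: derivable_uptoM.
apply: derivable_uptoM => //; first exact: derivable_upto_cst.
exact: derivable_uptoM.
Qed.

Lemma derivable_upto_normv n I (u : R -> 'rV[R]_3) :
  open I -> (forall t, I t -> u t != 0) -> derivable_upto n I u ->
  derivable_upto n I (fun t => normv (u t)).
Proof.
move=> oI u0 du; apply: derivable_upto_sqrt => // [t /u0|].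
  by rewrite dotvv_gt0.
exact: derivable_upto_dotv.
Qed.

(** One order is lost on both functions: on [u] by differentiation, on [c] through the speed. *)
Lemma derivable_upto_arc_deriv n I (c u : R -> 'rV[R]_3) :
  open I -> (forall t, I t -> (c^`() t)%classic != 0) ->
  derivable_upto n.+1 I c -> derivable_upto n.+1 I u ->
  derivable_upto n I (arc_deriv c u).
Proof.
move=> oI c0 dc du.
have speed0 t : I t -> speed c t != 0 by move=> /c0; rewrite /speed normv_eq0.
apply: derivable_upto_scale => //; last exact: derivable_upto_derive1.
apply: derivable_uptoV => //; apply: derivable_upto_normv => //.
exact: derivable_upto_derive1.
Qed.

End smoothness.

(** * Constant functions and vanishing derivatives *)

Section constant_functions.
Context {R : realType}.
Implicit Types (I : set R) (t : R).

Lemma is_derive_unique (V : normedModType R) (f : R -> V) t (a b : V) :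
  is_derive t 1 f a -> is_derive t 1 f b -> a = b.
Proof. by move=> [_ <-] [_ <-]. Qed.

Lemma is_derive_cst_on (V : normedModType R) I (f : R -> V) (k : V) t :
  open I -> (forall s, I s -> f s = k) -> I t -> is_derive t 1 f 0.
Proof.
move=> oI fk It; apply: (is_derive_on (f := cst k) oI _ It) => s.
by rewrite inE => /fk.
Qed.

(** Differentiating a relation u . v = k is the source of all the Frenet equations below. *)
Lemma dotv_cst_derive I (u v : R -> 'rV[R]_3) (k : R) t (u' v' : 'rV[R]_3) :
  open I -> (forall s, I s -> dotv (u s) (v s) = k) -> I t ->
  is_derive t 1 u u' -> is_derive t 1 v v' ->
  dotv u' (v t) + dotv (u t) v' = 0.
Proof.
move=> oI uvk It du dv.
exact: is_derive_unique (is_derive_dotv du dv) (is_derive_cst_on oI uvk It).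
Qed.

(** Mean value theorem on the segment joining the two points, which lies in the interval [I]. *)
Lemma is_derive0_cst_on I (f : R -> R) s t :
  is_interval I -> (forall x, I x -> is_derive x 1 f 0) -> I s -> I t ->
  f s = f t.
Proof.
move=> iI df; wlog le_st : s t / s <= t => [hw Is It|Is It].
  by have [/hw|/ltW/hw] := leP s t; [exact|move=> ->].
have dfi x : x \in `[s, t] -> is_derive x 1 f 0.
  by rewrite in_itv /= => stx; apply: df; exact: iI Is It _ stx.
have fcont : {within `[s, t], continuous f}.
  by apply: derivable_within_continuous => x /dfi[].
have dfo x : x \in `]s, t[ -> is_derive x 1 f ((fun=> 0) x).
  by move=> xst; apply: dfi; exact: subset_itv_oo_cc.
have [c _] := MVT_segment le_st dfo fcont.
by rewrite mul0r => /eqP; rewrite subr_eq0 => /eqP.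
Qed.

Lemma is_derive0_cst_on_vec I (u : R -> 'rV[R]_3) s t :
  is_interval I -> (forall x, I x -> is_derive x 1 u 0) -> I s -> I t ->
  u s = u t.
Proof.
move=> iI du Is It; apply/rowP => i.
apply: (is_derive0_cst_on (f := fun x => u x 0 i) iI _ Is It) => x /du.
by move=> /is_derive_rowP/(_ i); rewrite mxE.
Qed.

End constant_functions.

(** * Frenet equations at arbitrary speed, and Lancret's theorem *)

Section frenet.
Context {R : realType} (I : set R) (c : R -> 'rV[R]_3).
Context (cI : frenet_curve I c).

Let oI : open I. Proof. by case: cI => -[]. Qed.

Let v := speed c.
Let T := tangent c.
Let N := normal c.
Let B := binormal c.
Let kappa := curvature c.
Let tau := torsion c.

Lemma speed_gt0 t : I t -> 0 < v t.
Proof. by case: cI => _ _ c0 _ /c0; rewrite /v /speed normv_gt0. Qed.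

Lemma speed_neq0 t : I t -> v t != 0.
Proof. by move=> /speed_gt0/lt0r_neq0. Qed.

Lemma curvature_gt0 t : I t -> 0 < kappa t.
Proof.
by case: cI => _ _ _ k0 /k0; rewrite /kappa /curvature normv_gt0 normv_eq0.
Qed.

Lemma curvature_neq0 t : I t -> kappa t != 0.
Proof. by move=> /curvature_gt0/lt0r_neq0. Qed.

Lemma derivable_upto_curve n : derivable_upto n I c.
Proof. by case: cI => _ sc _ _; apply/derivable_uptoP => k _ t; exact: sc. Qed.

Let derivable_upto_arc n (u : R -> 'rV[R]_3) :
  derivable_upto n.+1 I u -> derivable_upto n I (arc_deriv c u).
Proof.
case: cI => _ _ c0 _; apply: derivable_upto_arc_deriv => //.
exact: derivable_upto_curve.
Qed.

Lemma derivable_upto_tangent n : derivable_upto n I T.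
Proof. exact/derivable_upto_arc/derivable_upto_curve. Qed.

Lemma derivable_upto_curvature n : derivable_upto n I kappa.
Proof.
apply: derivable_upto_normv => // [t /curvature_neq0|].
  by rewrite /kappa /curvature normv_eq0.
exact/derivable_upto_arc/derivable_upto_tangent.
Qed.

Lemma derivable_upto_normal n : derivable_upto n I N.
Proof.
apply: derivable_upto_scale => //.
  apply: derivable_uptoV => //; first exact: curvature_neq0.
  exact: derivable_upto_curvature.
exact/derivable_upto_arc/derivable_upto_tangent.
Qed.

Lemma derivable_upto_binormal n : derivable_upto n I B.
Proof.
apply: derivable_upto_crossv => //; first exact: derivable_upto_tangent.
exact: derivable_upto_normal.
Qed.

(** Returns from the arclength derivative to the derivative in the parameter. The speed factor is
    kept because the results are also applied to the curve [B], whose speed is in general not 1. *)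
Lemma derive1_arc_deriv (u : R -> 'rV[R]_3) t : I t -> derivable_upto 0 I u ->
  is_derive t 1 u (v t *: arc_deriv c u t).
Proof.
move=> It du; rewrite /arc_deriv scalerA divff ?speed_neq0 // scale1r.
exact: is_derive1 (derivable_upto_derivable du It).
Qed.

(** Applied to the vectors of the frame, this is the skew-symmetry of the Frenet matrix. *)
Lemma dotv_arc_deriv (u w : R -> 'rV[R]_3) (k : R) t : I t ->
  (forall n, derivable_upto n I u) -> (forall n, derivable_upto n I w) ->
  (forall s, I s -> dotv (u s) (w s) = k) ->
  dotv (arc_deriv c u t) (w t) = - dotv (u t) (arc_deriv c w t).
Proof.
move=> It du dw uwk; apply/eqP; rewrite -addr_eq0.
have := dotv_cst_derive oI uwk It
  (derive1_arc_deriv It (du 0%N)) (derive1_arc_deriv It (dw 0%N)).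
move: (arc_deriv c u t) (arc_deriv c w t) (u t) (w t) => u' w' ut wt.
rewrite dotvZl dotvZr -mulrDr => /eqP.
by rewrite mulf_eq0 (negbTE (speed_neq0 It)).
Qed.

Lemma dotv_arc_deriv_unit (u : R -> 'rV[R]_3) (k : R) t : I t ->
  (forall n, derivable_upto n I u) -> (forall s, I s -> dotv (u s) (u s) = k) ->
  dotv (arc_deriv c u t) (u t) = 0.
Proof.
move=> It du uk; have := dotv_arc_deriv It du du uk; rewrite dotvC => /eqP.
by rewrite -addr_eq0 -mulr2n mulrn_eq0 => /eqP.
Qed.

Lemma tangent_unit t : I t -> dotv (T t) (T t) = 1.
Proof.
move=> It; rewrite /T /tangent /arc_deriv dotvZl dotvZr -sqr_normv.
by rewrite -/(speed c t) mulrA -invfM -expr2 mulVf // expf_neq0 // speed_neq0.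
Qed.

Lemma normal_unit t : I t -> dotv (N t) (N t) = 1.
Proof.
move=> It; rewrite /N /normal dotvZl dotvZr -sqr_normv.
rewrite -/(curvature c t) mulrA -invfM -expr2 mulVf // expf_neq0 //.
exact: curvature_neq0.
Qed.

Lemma arc_deriv_tangent t : I t -> arc_deriv c T t = kappa t *: N t.
Proof. by move=> It; rewrite scalerA divff ?curvature_neq0 // scale1r. Qed.

Lemma tangent_frenet t : I t -> is_derive t 1 T ((v t * kappa t) *: N t).
Proof.
move=> It; rewrite -scalerA -arc_deriv_tangent //;
apply: derive1_arc_deriv => //.
exact: derivable_upto_tangent.
Qed.

Lemma tangent_normal t : I t -> dotv (T t) (N t) = 0.
Proof.
move=> It; have := dotv_arc_deriv_unit It derivable_upto_tangent tangent_unit.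
rewrite arc_deriv_tangent // dotvZl dotvC => /eqP.
by rewrite mulf_eq0 (negbTE (curvature_neq0 It)) => /eqP.
Qed.

Lemma tangent_binormal t : dotv (T t) (B t) = 0.
Proof. exact: dotv_crossvl. Qed.

Lemma normal_binormal t : dotv (N t) (B t) = 0.
Proof. exact: dotv_crossvr. Qed.

Lemma binormal_unit t : I t -> dotv (B t) (B t) = 1.
Proof.
move=> It; have := dotv_sqr_crossv (T t) (N t).
by rewrite tangent_normal // tangent_unit // normal_unit // expr0n add0r mulr1.
Qed.

Lemma frenet_expand t (w : 'rV[R]_3) : I t ->
  w = dotv w (T t) *: T t + dotv w (N t) *: N t + dotv w (B t) *: B t.
Proof.
move=> It.
exact (orthonormal_expand w (tangent_unit It) (normal_unit It)
  (tangent_normal It)).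
Qed.

(** Coordinates in the frame: B' . B = 0 as [B] is a unit vector, B' . T = - B . T' = - kappa (B .
    N) = 0, and B' . N is - tau by definition. *)
Lemma arc_deriv_binormal t : I t -> arc_deriv c B t = - tau t *: N t.
Proof.
move=> It; rewrite (frenet_expand (arc_deriv c B t) It).
have -> : dotv (arc_deriv c B t) (B t) = 0.
  exact: dotv_arc_deriv_unit derivable_upto_binormal binormal_unit.
have -> : dotv (arc_deriv c B t) (T t) = 0.
  have -> := dotv_arc_deriv It derivable_upto_binormal derivable_upto_tangent
    (fun s _ => etrans (dotvC _ _) (tangent_binormal s)).
  rewrite arc_deriv_tangent // (dotvZr (kappa t)) dotvC normal_binormal.
  by rewrite mulr0 oppr0.
by rewrite !scale0r add0r addr0 /tau /torsion opprK.
Qed.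

(** By skew-symmetry, the coordinates of N' along [T] and [B] are read off from T' = kappa N and
    from the definition of [torsion]. *)
Lemma arc_deriv_normal t : I t ->
  arc_deriv c N t = tau t *: B t - kappa t *: T t.
Proof.
move=> It; rewrite (frenet_expand (arc_deriv c N t) It).
have -> : dotv (arc_deriv c N t) (N t) = 0.
  exact: dotv_arc_deriv_unit derivable_upto_normal normal_unit.
have -> : dotv (arc_deriv c N t) (T t) = - kappa t.
  have -> := dotv_arc_deriv It derivable_upto_normal derivable_upto_tangent
    (fun s Is => etrans (dotvC _ _) (tangent_normal Is)).
  by rewrite arc_deriv_tangent // (dotvZr (kappa t)) normal_unit // mulr1.
have -> : dotv (arc_deriv c N t) (B t) = tau t.
  have -> := dotv_arc_deriv It derivable_upto_normal derivable_upto_binormal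
    (fun s _ => normal_binormal s).
  by rewrite dotvC.
by rewrite (scale0r (N t)) addr0 (scaleNr (kappa t)) [LHS]addrC.
Qed.

Lemma binormal_frenet t : I t -> is_derive t 1 B (- (v t * tau t) *: N t).
Proof.
move=> It; rewrite -mulrN -scalerA -arc_deriv_binormal //.
exact: derive1_arc_deriv It (derivable_upto_binormal 0).
Qed.

Lemma normal_frenet t : I t ->
  is_derive t 1 N (v t *: (tau t *: B t - kappa t *: T t)).
Proof.
move=> It; rewrite -arc_deriv_normal //.
exact: derive1_arc_deriv It (derivable_upto_normal 0).
Qed.

(* If [tau / kappa] is a constant [k], then [k T + B] is a fixed axis.
   Conversely, if [T] makes a constant angle with a line spanned by [u], then
   [u] is orthogonal to [N], and has constant coordinates [a], [b] along [T] and
   [B] with [kappa * a = tau * b]. *)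
Lemma lancret :
  constant_ratio I c <->
  exists (u : 'rV[R]_3) (m : R),
    u != 0 /\ forall t, I t -> dotv (T t) u ^+ 2 = m.
Proof.
have [[_ iI [t0 It0]] _ _ _] := cI.
split=> [[k tk]|[u [m [u0 Tum]]]].
  pose w t := k *: T t + B t.
  have dw t : I t -> is_derive t 1 w 0.
    move=> It; have dT := tangent_frenet It; have dB := binormal_frenet It.
    apply: is_derive_eq (is_deriveD (is_deriveZ k dT) dB) _.
    rewrite scalerA -scalerDl.
    have -> : tau t = k * kappa t by rewrite -(tk t It) divfK // curvature_neq0.
    by rewrite (_ : _ + _ = 0) ?scale0r //; ring.
  have wT t : I t -> dotv (T t) (w t) = k.
    by move=> It; rewrite dotvDr dotvZr tangent_unit // tangent_binormal
      mulr1 addr0.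
  exists (w t0), (k ^+ 2); split=> [|t It].
    (* The axis is nonzero because its component along [B] is 1. *)
    have wB : dotv (B t0) (w t0) = 1.
      by rewrite dotvDr dotvZr (dotvC _ (T t0)) tangent_binormal mulr0
        add0r binormal_unit.
    by apply: contra_eqN wB => /eqP ->; rewrite dotv0 eq_sym oner_neq0.
  by rewrite -(is_derive0_cst_on_vec iI dw It It0) wT.
have du (t : R) : is_derive t 1 (cst u) 0 by exact: is_derive_cst.
have dTu t : I t ->
    is_derive t 1 (fun x => dotv (T x) u) (v t * kappa t * dotv (N t) u).
  move=> It; apply: is_derive_eq (is_derive_dotv (tangent_frenet It) (du t)) _.
  by rewrite dotv0 addr0 dotvZl.
have Nu t : I t -> dotv (N t) u = 0.
  move=> It; have vk0 := mulf_neq0 (speed_neq0 It) (curvature_neq0 It).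
  suff /eqP : v t * kappa t * dotv (N t) u = 0.
    by rewrite mulf_eq0 (negbTE vk0) => /eqP.
  (* Differentiating (T . u)^2 = m gives (T . u) (T . u)' = 0, which determines the second factor
     when m is nonzero. When m = 0, T . u itself vanishes on [I], hence so does its derivative. *)
  have [m0|m0] := eqVneq m 0.
    apply: is_derive_unique (dTu t It) _.
    apply: (is_derive_cst_on (k := 0) oI _ It) => s Is.
    by apply/eqP; rewrite -sqrf_eq0 Tum // m0.
  have := is_derive_unique (is_deriveM (dTu t It) (dTu t It))
    (is_derive_cst_on oI Tum It).
  move=> /eqP; rewrite -mulr2n mulrn_eq0 /= mulf_eq0 => /orP[/eqP Tu0|/eqP//].
  by move: m0; rewrite -(Tum t It) Tu0 expr0n eqxx.
(* This is the derivative of the relation N . u = 0. *)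
have kTu t : I t -> tau t * dotv (B t) u = kappa t * dotv (T t) u.
  move=> It; have := dotv_cst_derive oI Nu It (normal_frenet It) (du t).
  rewrite dotv0 addr0 dotvZl dotvDl -(scaleNr (kappa t)) !dotvZl.
  rewrite (mulNr (kappa t)) => /eqP.
  by rewrite mulf_eq0 (negbTE (speed_neq0 It)) subr_eq0 => /eqP.
have cT t : I t -> dotv (T t) u = dotv (T t0) u.
  move=> It; apply: (is_derive0_cst_on (f := fun t => dotv (T t) u)
    iI _ It It0).
  by move=> s Is; apply: is_derive_eq (dTu s Is) _; rewrite Nu // mulr0.
have cB t : I t -> dotv (B t) u = dotv (B t0) u.
  move=> It; apply: (is_derive0_cst_on (f := fun t => dotv (B t) u)
    iI _ It It0).
  move=> s Is.
  apply: is_derive_eq (is_derive_dotv (binormal_frenet Is) (du s)) _.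
  by rewrite dotv0 addr0 dotvZl Nu // mulr0.
(* If B . u vanished at [t0], then kappa (T . u) = tau (B . u) would make T . u vanish as well, so
   all three coordinates of [u] would be 0. *)
have Bu0 : dotv (B t0) u != 0.
  apply: contraNneq u0 => Bu; apply/eqP.
  have /eqP := kTu t0 It0; rewrite Bu mulr0 eq_sym mulf_eq0.
  rewrite (negbTE (curvature_neq0 It0)) => /eqP Tu.
  by rewrite (frenet_expand u It0) !(dotvC u) Tu Nu // Bu !scale0r !addr0.
exists (dotv (T t0) u / dotv (B t0) u) => t It; apply/eqP.
rewrite eqr_div ?curvature_neq0 // -/tau -(cB t It) -(cT t It).
by rewrite kTu // mulrC.
Qed.

End frenet.

(** * The binormal indicatrix as a Frenet curve on the unit sphere *)

Section binormal_indicatrix.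
Context {R : realType} (I : set R) (c : R -> 'rV[R]_3).
Context (cI : frenet_curve I c) (tau0 : non_planar I c).

Let b := binormal c.

Lemma derive1_binormal t : I t ->
  (b^`() t)%classic = - (speed c t * torsion c t) *: normal c t.
Proof. by move=> It; exact: is_derive1E (binormal_frenet cI It). Qed.

Lemma derive1_binormal_neq0 t : I t -> (b^`() t)%classic != 0.
Proof.
move=> It; rewrite derive1_binormal // scaler_eq0 oppr_eq0 mulf_eq0.
rewrite (negbTE (speed_neq0 cI It)) (negbTE (tau0 It)) /=.
by rewrite -dotvv_eq0 (normal_unit cI It) oner_neq0.
Qed.

Lemma tangent_binormal_indicatrix t : I t ->
  tangent b t = - Num.sg (torsion c t) *: normal c t.
Proof.
move=> It; rewrite /tangent /arc_deriv /speed derive1_binormal // normvZ.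
have -> : normv (normal c t) = 1 by rewrite /normv (normal_unit cI It) sqrtr1.
have v0 := speed_gt0 cI It.
rewrite mulr1 scalerA normrN normrM (gtr0_norm v0); congr (_ *: _).
(* Splitting tau into its sign and its absolute value lets the latter cancel against the speed of
   the indicatrix. *)
rewrite {2}(numEsg (torsion c t)).
have : `|torsion c t| != 0 by rewrite normr_eq0 tau0.
by move: (speed_neq0 cI It) => ? ?; field; apply/andP.
Qed.

Lemma tangent_binormal_indicatrix_sqr t u : I t ->
  dotv (tangent b t) u ^+ 2 = dotv (normal c t) u ^+ 2.
Proof.
move=> It; rewrite tangent_binormal_indicatrix // dotvZl exprMn sqrrN sqr_sg.
by rewrite tau0 // mul1r.
Qed.

(** Regularity comes from the nonvanishing torsion. For the curvature, the tangent of [b] is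
    orthogonal to that of [c]. If its derivative vanished at a point, differentiating this relation
    would leave - sg(tau) N . (v kappa N) = 0, with [v] the speed of [c], although sg(tau), [v] and
    kappa are all nonzero. No derivative of the sign of tau is taken. *)
Lemma frenet_curve_binormal : frenet_curve I b.
Proof.
have [oiI _ _ _] := cI; have [oI _ _] := oiI.
have db n : derivable_upto n I b by exact: derivable_upto_binormal cI n.
split=> //.
- by move=> n t It; exact: (derivable_uptoP n I b).1 (db n) n (leqnn n) t It.
- exact: derive1_binormal_neq0.
- move=> t It; rewrite /curvature normv_eq0; apply/eqP => arc0.
  have db_tangent : derivable_upto 0 I (tangent b).
    exact: derivable_upto_arc_deriv oI derive1_binormal_neq0 (db _) (db _).
  have dbt := is_derive1 (derivable_upto_derivable db_tangent It).
  have tangents s : I s -> dotv (tangent b s) (tangent c s) = 0.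
    move=> Is; rewrite tangent_binormal_indicatrix // dotvZl dotvC.
    by rewrite (tangent_normal cI Is) mulr0.
  have := dotv_cst_derive oI tangents It dbt (tangent_frenet cI It).
  have -> : ((tangent b)^`() t)%classic = 0.
    move/eqP: arc0; rewrite /arc_deriv scaler_eq0 invr_eq0 normv_eq0.
    by rewrite (negbTE (derive1_binormal_neq0 It)) => /eqP.
  rewrite dotvC dotv0 add0r tangent_binormal_indicatrix // dotvZl.
  rewrite (dotvZr (_ * _)) (normal_unit cI It) mulr1 => /eqP.
  rewrite !mulf_eq0 oppr_eq0 sgr_eq0 (negbTE (tau0 It)).
  by rewrite (negbTE (speed_neq0 cI It)) (negbTE (curvature_neq0 cI It)).
Qed.

Lemma spherical_helix_binormal :
  spherical_helix I b <->
  exists (u : 'rV[R]_3) (m : R),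
    u != 0 /\ forall t, I t -> dotv (normal c t) u ^+ 2 = m.
Proof.
have fb := frenet_curve_binormal.
have lb : constant_ratio I b <-> _ := lancret fb.
split=> [[_ _ /lb[u [m [u0 um]]]]|[u [m [u0 um]]]].
  by exists u, m; split=> // t It; rewrite -tangent_binormal_indicatrix_sqr ?um.
split=> //; first by move=> t It; rewrite /normv (binormal_unit cI It) sqrtr1.
by apply/lb; exists u, m; split=> // t It;
   rewrite tangent_binormal_indicatrix_sqr ?um.
Qed.

End binormal_indicatrix.

(** * Slant helices and the transfer along a Bertrand pair *)

(** Since [N] is a unit vector, the angle with the line of [u] and the number (N . u)^2 determine
    each other once [u] is fixed; this removes [acos] from the condition. *)
Lemma slant_helixP (R : realType) (I : set R) (c : R -> 'rV[R]_3) :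
  frenet_curve I c ->
  slant_helix I c <->
  exists (u : 'rV[R]_3) (m : R),
    u != 0 /\ forall t, I t -> dotv (normal c t) u ^+ 2 = m.
Proof.
move=> cI.
have nN t : I t -> normv (normal c t) = 1.
  by move=> It; rewrite /normv (normal_unit cI It) sqrtr1.
split=> [[_ [u [theta [u0 utheta]]]]|[u [m [u0 um]]]].
  exists u, ((cos theta * normv u) ^+ 2); split=> // t It.
  have nu := u0; rewrite -normv_gt0 in nu.
  rewrite -(utheta t It) /line_angle nN // mul1r acosK.
    by rewrite divfK ?gt_eqF // real_normK // num_real.
  (* [acosK] requires |N . u| / |u| to lie in [-1, 1]; the upper bound is Cauchy-Schwarz. *)
  rewrite in_itv /=; apply/andP; split.
    by rewrite (le_trans (lerN10 R)) // divr_ge0 // ltW.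
  rewrite (ler_pdivrMr _ _ nu) mul1r -[leRHS]mul1r -(nN t It).
  exact: Cauchy_Schwarz.
(* As m = (N . u)^2, its square root is |N . u|, whence the witness for the angle. *)
split=> //; exists u, (acos (Num.sqrt m / normv u)); split=> // t It.
by rewrite /line_angle nN // mul1r -(um t It) sqrtr_sqr.
Qed.

Theorem theorem12 (R : realType) (I J : set R) (gamma gammat : R -> 'rV[R]_3)
    (hgamma : arclength_curve I gamma)
    (hgammat : arclength_curve J gammat)
    (hpair : bertrand_pair I J gamma gammat)
    (hnh : non_helical I gamma)
    (hnh' : non_helical J gammat)
    (hnp : non_planar I gamma)
    (hnp' : non_planar J gammat)
    (hq : admissible_quotients I gamma)
    (hq' : admissible_quotients J gammat) :
  slant_helix J gammat <-> spherical_helix I (binormal gamma).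
Proof.
have [cI _] := hgamma; have [dJ _] := hgammat.
have [phi [eps [lambda [[phiIJ _ phiS] epsE _ normalE _]]]] := hpair.
have normals s u : I s ->
    dotv (normal gamma s) u ^+ 2 = dotv (normal gammat (phi s)) u ^+ 2.
  move=> Is; rewrite normalE // dotvZl exprMn.
  by case: epsE => ->; rewrite ?sqrrN expr1n mul1r.
apply: iff_trans (slant_helixP dJ) _.
apply: iff_trans _ (iff_sym (spherical_helix_binormal cI hnp)).
(* The same [u] and [m] serve both curves. Passing from the mate to [gamma] uses that [phi] maps [I]
   into [J]; the way back uses that it is onto [J]. *)
split=> -[u [m [u0 um]]]; exists u, m; split=> //.
  by move=> s Is; rewrite normals // um //; exact: phiIJ.
by move=> t /phiS[s Is <-]; rewrite -normals // um.
Qed.
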